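(* There is no tournament $T$ having two distinct minimal $\tau$-retentive sets $R_1$ and $R_2$ with $|R_1|=|R_2|=7$.
   Context: A tournament $T$ consists of a finite vertex set $V(T)$ and an asymmetric, complete binary relation $\succ$ on $V(T)$ ($x$ dominates $y$ if $x\succ y$). For $v\in V(T)$ let $N^-_T(v)=\{u\in V(T): u\succ v\}$; for $B\subseteq V(T)$, $T[B]$ is the induced subtournament. The tournament equilibrium set $\tau$ is defined recursively: a nonempty $A\subseteq V(T)$ is $\tau$-retentive if for every $v\in A$ with $N^-_T(v)\neq\emptyset$, $\tau(T[N^-_T(v)])\subseteq A$; $A$ is a minimal $\tau$-retentive set if no $\tau$-retentive set of $T$ is a proper subset of $A$; $\tau(T)$ is the union of all minimal $\tau$-retentive sets of $T$. *)

(* Defs.v *)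
From mathcomp Require Import all_boot.

Set Implicit Arguments.
Unset Strict Implicit.
Unset Printing Implicit Defensive.

Record tournament := Tournament {
  vertex :> finType;
  dominates : rel vertex;
  dominates_asym : forall x y, dominates x y -> ~~ dominates y x;
  dominates_complete :
    forall x y, x != y -> dominates x y || dominates y x
}.

(* The induced subtournament T[B] is represented by its vertex set B, so that
   tau is a function of the subsets of V(T); T itself is [set: T]. *)
Section TournamentEquilibriumSet.

Variable T : tournament.
Implicit Types (A B C : {set T}) (S : {set T} -> {set T}).

(* N^-_{T[B]}(v) *)
Definition in_neighbours B (v : T) : {set T} :=
  [set u in B | dominates u v].

(* A is an S-retentive set of T[B]. *)
Definition retentive S B A : bool :=
  [&& A != set0, A \subset B &
    [forall v in A, (in_neighbours B v != set0) ==>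
                    (S (in_neighbours B v) \subset A)]].

Definition minimal_retentive S B A : bool := minset (retentive S B) A.

Definition union_minimal_retentive S B : {set T} :=
  \bigcup_(A : {set T} | minimal_retentive S B A) A.

(* The recursion is on a bound for #|B|, since in_neighbours B v is smaller
   than B for v in B; tauE below is the defining equation of tau. *)
Fixpoint tau_bounded (n : nat) B : {set T} :=
  if n is n'.+1 then union_minimal_retentive (tau_bounded n') B else set0.

Definition tau B : {set T} := tau_bounded #|B| B.

Lemma card_in_neighbours B v : v \in B -> #|in_neighbours B v| < #|B|.
Proof.
move=> vB; apply: proper_card; apply/properP; split.
  by apply/subsetP=> u; rewrite inE => /andP[].
exists v => //; rewrite inE vB /=; apply/negP=> vv.
by have := dominates_asym vv; rewrite vv.
Qed.

Lemma eq_union_minimal_retentive S1 S2 B :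
  (forall C, #|C| < #|B| -> S1 C = S2 C) ->
  union_minimal_retentive S1 B = union_minimal_retentive S2 B.
Proof.
move=> eqS; apply: eq_bigl => A; apply: minset_eq => {}A.
rewrite /retentive; case: (A != set0) => //=.
case: (boolP (A \subset B)) => //= /subsetP sAB.
apply: eq_forallb => v; case: (boolP (v \in A)) => //= /sAB vB.
by rewrite eqS ?card_in_neighbours.
Qed.

Lemma tau_boundedE n B : #|B| <= n -> tau_bounded n B = tau B.
Proof.
have [m] := ubnP #|B|; elim: m n B => // m IH [|n] B; rewrite /tau.
  by move=> _; rewrite leqn0 => /eqP ->.
case: (posnP #|B|) => [B0 _ _ | B0].
  rewrite B0 /= /union_minimal_retentive big_pred0 // => A.
  apply/negP=> /minsetp /and3P[/negP A0 + _]; rewrite (cards0_eq B0).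
  by rewrite subset0.
rewrite ltnS -(prednK B0) /= => leBm leBn.
apply: eq_union_minimal_retentive => C; rewrite -(prednK B0) ltnS => leC.
have ltCm := leq_ltn_trans leC leBm.
by rewrite !IH // (leq_trans leC).
Qed.

Lemma tauE B : tau B = \bigcup_(A : {set T} | minimal_retentive tau B A) A.
Proof.
rewrite -(tau_boundedE (leqnSn _)) /=.
by apply: eq_union_minimal_retentive => C /ltnW; apply: tau_boundedE.
Qed.

End TournamentEquilibriumSet.

Definition minimal_tau_retentive (T : tournament) (R : {set T}) : bool :=
  minimal_retentive (@tau T) [set: T] R.

(* Main.v *)
(* Distinct minimal retentive sets are disjoint. Let A be a minimal retentive
   set with at most 7 elements of a tournament B, and suppose that minimal
   retentive sets with fewer than #|A| elements are known to be unique. Then A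
   is also minimal retentive in the tournament it induces, and the set S of the
   elements of A dominated by a vertex outside A is constrained: if a is in S,
   the same holds for tau (N^-(a)), a smaller minimal retentive set. For each of
   the finitely many tournaments A the constraints are so strong that A carries
   weights of which every S has less than half. Two disjoint minimal retentive
   sets A1 and A2 of this kind are impossible: weighing the edges between them
   by products, less than half would go from A1 to A2 and less than half from
   A2 to A1. *)

Require Import Defs.
From mathcomp Require Import all_boot.

Set Implicit Arguments.
Unset Strict Implicit.
Unset Printing Implicit Defensive.

(** * Retentive sets *)

Section RetentiveSets.

Variable T : tournament.
Implicit Types (A B C D S : {set T}) (a u v x : T).

Local Notation tau := (@tau T).
Local Notation minret := (minimal_retentive tau).

Lemma retentive_sub B A : retentive tau B A -> A \subset B.
Proof. by case/and3P. Qed.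

Lemma retentive_neq0 B A : retentive tau B A -> A != set0.
Proof. by case/and3P. Qed.

Lemma tau0 : tau set0 = set0.
Proof. by rewrite /Defs.tau cards0. Qed.

Lemma retentive_tau B A v :
  retentive tau B A -> v \in A -> tau (in_neighbours B v) \subset A.
Proof.
case/and3P=> _ _ /forall_inP retA /retA/implyP.
by case: eqP => [-> _ | _ ->] //; rewrite tau0 sub0set.
Qed.

Lemma retentiveI_tau B A : A != set0 -> A \subset B ->
  (forall v, v \in A -> tau (in_neighbours B v) \subset A) -> retentive tau B A.
Proof.
move=> A0 sAB tauA; apply/and3P; split=> //.
by apply/forall_inP=> v /tauA ->; rewrite implybT.
Qed.

Lemma retentive_setI B A1 A2 v : retentive tau B A1 -> retentive tau B A2 ->
  v \in A1 -> v \in A2 -> retentive tau B (A1 :&: A2).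
Proof.
move=> retA1 retA2 vA1 vA2; apply: retentiveI_tau.
- by apply/set0Pn; exists v; rewrite inE vA1.
- by rewrite subIset // retentive_sub.
by move=> u /setIP[uA1 uA2]; rewrite subsetI !(retentive_tau (B := B)).
Qed.

Lemma minret_retentive B A : minret B A -> retentive tau B A.
Proof. exact: minsetp. Qed.

Lemma minret_sub B A : minret B A -> A \subset B.
Proof. by move/minret_retentive/retentive_sub. Qed.

Lemma minret_meet B A1 A2 v : minret B A1 -> retentive tau B A2 ->
  v \in A1 -> v \in A2 -> A1 \subset A2.
Proof.
move=> minA1 retA2 vA1 vA2; apply/setIidPl; apply: (minsetinf minA1).
  by apply: (retentive_setI (v := v)) => //; apply: minret_retentive.
exact: subsetIl.
Qed.

Lemma minret_eq B A1 A2 v :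
  minret B A1 -> minret B A2 -> v \in A1 -> v \in A2 -> A1 = A2.
Proof.
move=> minA1 minA2 vA1 vA2; apply/eqP.
by rewrite eqEsubset !(minret_meet (B := B) (v := v)) //; apply: minret_retentive.
Qed.

Lemma in_neighbours_sub B v : in_neighbours B v \subset B.
Proof. by apply/subsetP=> u; rewrite inE => /andP[]. Qed.

Lemma in_neighboursS B1 B2 v :
  B1 \subset B2 -> in_neighbours B1 v \subset in_neighbours B2 v.
Proof.
by move=> /subsetP sB; apply/subsetP=> u; rewrite !inE => /andP[/sB -> ->].
Qed.

Lemma minret_sub_tau B A : minret B A -> A \subset tau B.
Proof. by move=> minA; rewrite tauE (bigcup_sup A). Qed.

Lemma mem_tau B v : reflect (exists2 A, minret B A & v \in A) (v \in tau B).
Proof. by rewrite tauE; apply: (iffP bigcupP) => -[A]; exists A. Qed.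

Lemma tau_sub B : tau B \subset B.
Proof.
by apply/subsetP=> v /mem_tau[A minA]; apply: (subsetP (minret_sub minA)).
Qed.

Lemma retentiveT B : B != set0 -> retentive tau B B.
Proof.
move=> B0; apply: retentiveI_tau => // v _.
exact: subset_trans (tau_sub _) (in_neighbours_sub _ _).
Qed.

Lemma exists_minret B : B != set0 -> exists A, minret B A.
Proof. by case/retentiveT/minset_exists => A minA _; exists A. Qed.

Lemma tau_eq0 B : (tau B == set0) = (B == set0).
Proof.
apply/eqP/eqP => [tB0 | ->]; last exact: tau0.
apply/eqP; apply: contraT => /exists_minret[A minA].
have := minret_sub_tau minA; rewrite tB0 subset0.
by rewrite (negPf (retentive_neq0 (minret_retentive minA))).
Qed.

(** * Closure under [tau] of in-neighbourhoods *)

Definition tau_succ B (v : T) : {set T} :=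
  if v \in B then tau (in_neighbours B v) else set0.

Definition reach_step B C := C :|: \bigcup_(x in C) tau_succ B x.

(** For [v] in [B] this is the least retentive set containing [v]. A step that changes the set adds
    a vertex of [B], so [#|B|] steps reach a fixed point. *)
Definition reach B v := iter #|B| (reach_step B) [set v].

Lemma tau_succ_sub B v : tau_succ B v \subset B.
Proof.
rewrite /tau_succ; case: ifP => _; last exact: sub0set.
exact: subset_trans (tau_sub _) (in_neighbours_sub _ _).
Qed.

Lemma reach_step_sub B C : C \subset B -> reach_step B C \subset B.
Proof.
by move=> sCB; rewrite subUset sCB /=; apply/bigcupsP=> x _; apply: tau_succ_sub.
Qed.

Lemma iter_reach_step_sub B C n : C \subset B -> iter n (reach_step B) C \subset B.
Proof. by move=> sCB; elim: n => //= n; apply: reach_step_sub. Qed.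

Lemma iter_reach_step_stable B v n : v \in B ->
  let C := iter n (reach_step B) [set v] in reach_step B C = C \/ n < #|C|.
Proof.
move=> vB; elim: n => [|n /= [eqC | ltn]]; first by right; rewrite cards1.
  by left; rewrite !eqC.
set C := iter n _ _ in ltn *; set C' := reach_step B C.
have sCC' : C \subset C' by apply: subsetUl.
have [eqC | neC] := eqVneq C' C; first by left; rewrite eqC.
right; apply: leq_ltn_trans ltn _; apply: proper_card.
by rewrite properEneq eq_sym neC.
Qed.

Lemma reach_stable B v : v \in B -> reach_step B (reach B v) = reach B v.
Proof.
move=> vB; case: (iter_reach_step_stable #|B| vB) => // /=.
by rewrite ltnNge subset_leq_card // iter_reach_step_sub // sub1set.
Qed.

Lemma mem_reach B v : v \in reach B v.
Proof.
rewrite /reach; elim: #|B| => [|n] /=; first by rewrite set11.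
exact/subsetP/subsetUl.
Qed.

Lemma reach_sub B v : v \in B -> reach B v \subset B.
Proof. by move=> vB; rewrite iter_reach_step_sub // sub1set. Qed.

Lemma reach_retentive B v : v \in B -> retentive tau B (reach B v).
Proof.
move=> vB; apply: retentiveI_tau.
- by apply/set0Pn; exists v; apply: mem_reach.
- exact: reach_sub.
move=> x xR; rewrite -(reach_stable vB); apply: subset_trans (subsetUr _ _).
have xB : x \in B by apply: (subsetP (reach_sub vB)).
by apply: subset_trans (bigcup_sup x xR); rewrite /tau_succ xB.
Qed.

Lemma reach_min B A v : retentive tau B A -> v \in A -> reach B v \subset A.
Proof.
move=> retA vA; rewrite /reach; elim: #|B| => [|n IH] /=; first by rewrite sub1set.
rewrite subUset IH /=; apply/bigcupsP=> x /(subsetP IH) xA.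
rewrite /tau_succ; case: ifP => _; last exact: sub0set.
exact: retentive_tau.
Qed.

Lemma minret_reach B A v : minret B A -> v \in A -> reach B v = A.
Proof.
move=> minA vA; have retA := minret_retentive minA.
apply: (minsetinf minA); last exact: reach_min.
by apply: reach_retentive; apply: (subsetP (minret_sub minA)).
Qed.

(** Minimal retentive sets are the terminal strong components of the digraph with arcs from [x] to
    the members of [tau_succ B x]. This test is the one evaluated on bit sequences. *)
Lemma mem_tau_reach B v : v \in B ->
  (v \in tau B) = [forall (u | u \in reach B v), reach B v \subset reach B u].
Proof.
move=> vB; apply/mem_tau/forall_inP => [[A minA vA] u | terminal].
  by rewrite (minret_reach minA vA) => uA; rewrite (minret_reach minA uA).
exists (reach B v); last exact: mem_reach.
apply/minsetP; split; first exact: reach_retentive.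
move=> A retA sAR; apply/eqP; rewrite eqEsubset sAR /=.
have /set0Pn[u uA] := retentive_neq0 retA.
exact: subset_trans (terminal u (subsetP sAR u uA)) (reach_min retA uA).
Qed.

Definition minret_unique k := forall B A1 A2,
  minret B A1 -> minret B A2 -> #|A1| <= k -> #|A2| <= k -> A1 = A2.

(** * Minimal retentive sets in subtournaments *)

Section Heredity.

Variable k : nat.
Hypothesis uniq_k : minret_unique k.

(** Every minimal retentive set of [B] lies in [tau B], so all have at most [k] elements and
    coincide. *)
Lemma minret_tau B : B != set0 -> #|tau B| <= k -> minret B (tau B).
Proof.
move=> /exists_minret[A minA] tBk; suff -> : tau B = A by [].
have card_le A' : minret B A' -> #|A'| <= k.
  by move=> minA'; rewrite (leq_trans _ tBk) // subset_leq_card // minret_sub_tau.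
apply/eqP; rewrite eqEsubset minret_sub_tau // andbT.
apply/subsetP=> v /mem_tau[A' minA' vA'].
by rewrite (uniq_k minA minA') ?card_le.
Qed.

(** The first hypothesis is the induction hypothesis of [minret_hereditary]. If [in_neighbours B a]
    is nonempty, its [tau] lies in [A], hence in [B'], and is by induction minimal retentive in
    [in_neighbours B' a]. So is the [tau] of the latter, and uniqueness identifies the two. *)
Lemma tau_retentive_sub B A B' a :
    (forall C D D', minret D C -> C \subset D' -> D' \subset D ->
       #|D'| <= k -> #|D'| < #|B'| -> minret D' C) ->
    retentive tau B A -> A \subset B' -> B' \subset B -> #|B'| <= k.+1 ->
  a \in A -> tau (in_neighbours B' a) = tau (in_neighbours B a).
Proof.
move=> IH retA sAB' sB'B B'k aA.
have sN := in_neighboursS a sB'B.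
have [NB0 | NBn0] := eqVneq (in_neighbours B a) set0.
  by move: sN; rewrite NB0 subset0 => /eqP ->.
have aB' := subsetP sAB' a aA; have ltN := card_in_neighbours aB'.
(* The vertex [a] is missing from its own in-neighbourhood, which brings [k.+1] down to [k]. *)
have leN : #|in_neighbours B' a| <= k by rewrite -ltnS (leq_trans ltN).
have sCN : tau (in_neighbours B a) \subset in_neighbours B' a.
  apply/subsetP=> u uC; rewrite inE.
  rewrite (subsetP sAB') ?(subsetP (retentive_tau retA aA)) //=.
  by have := subsetP (tau_sub _) u uC; rewrite inE => /andP[].
have Ck : #|tau (in_neighbours B a)| <= k.
  exact: leq_trans (subset_leq_card sCN) leN.
have minC := IH _ _ _ (minret_tau NBn0 Ck) sCN sN leN ltN.
have NB'n0 : in_neighbours B' a != set0.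
  by apply: contraNneq NBn0 => NB'0; move: sCN; rewrite NB'0 subset0 tau_eq0.
have tk : #|tau (in_neighbours B' a)| <= k.
  exact: leq_trans (subset_leq_card (tau_sub _)) leN.
by apply: uniq_k (minret_tau NB'n0 tk) minC tk Ck.
Qed.

(** For [a] in [A], the [tau] of the in-neighbourhood of [a] is the same in [B] and [B'], so the
    same subsets of [A] are retentive in both. *)
Lemma minret_hereditary B A B' :
  minret B A -> A \subset B' -> B' \subset B -> #|B'| <= k.+1 -> minret B' A.
Proof.
have [n] := ubnP #|B'|; elim: n => // n IHn in B A B' *.
rewrite ltnS => B'n minA sAB' sB'B B'k.
have retA := minret_retentive minA.
have tauB' a : a \in A -> tau (in_neighbours B' a) = tau (in_neighbours B a).
  apply: tau_retentive_sub => // C D D' minC sCD' sD'D D'k D'B'.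
  by apply: (IHn D) => //; [apply: leq_trans B'n | apply: leqW].
apply/minsetP; split.
  apply: retentiveI_tau => // [|a aA]; first exact: retentive_neq0 retA.
  by rewrite tauB' // retentive_tau.
move=> A' retA' sA'A; apply: (minsetinf minA) => //.
apply: retentiveI_tau; first exact: retentive_neq0 retA'.
  exact: subset_trans sA'A (minret_sub minA).
by move=> a aA'; rewrite -tauB' ?(subsetP sA'A) // retentive_tau.
Qed.

Lemma tau_minret B A a : minret B A -> #|A| <= k.+1 -> a \in A ->
  tau (in_neighbours A a) = tau (in_neighbours B a).
Proof.
move=> minA Ak aA; apply: (tau_retentive_sub (A := A)) => //.
- by move=> C D D' minC sCD' sD'D /leqW D'k _; apply: (minret_hereditary minC).
- exact: minret_retentive.
- exact: minret_sub.
Qed.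

End Heredity.

(* The constraints, up to nesting depth n, on the set S of the elements of a
   minimal retentive set A that an outside vertex v can dominate: if v
   dominates a, then tau (N^-(a)) is a minimal retentive set of a tournament
   containing v, to which the same constraints apply. *)
Fixpoint dominable n A S : bool :=
  if n is n'.+1 then
    [forall (a | a \in S), (in_neighbours A a != set0) &&
      let C := tau (in_neighbours A a) in dominable n' C (S :&: C)]
  else true.

(** If [v] dominates [a], then [v] lies in [in_neighbours B a] but not in its [tau], a subset of
    [A]; the induction on [n] applies to this [tau]. *)
Lemma minret_dominable k n B A v : minret_unique k ->
  minret B A -> #|A| <= k.+1 -> v \in B -> v \notin A ->
  dominable n A (A :&: [set a | dominates v a]).
Proof.
move=> uniq_k; elim: n B A => // n IHn B A minA Ak vB vA /=.
apply/forall_inP=> a /setIP[aA]; rewrite inE => va.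
have vN : v \in in_neighbours B a by rewrite inE vB.
have Nn0 : in_neighbours B a != set0 by apply/set0Pn; exists v.
have tauA := tau_minret uniq_k minA Ak aA.
(* Otherwise the [tau] of [in_neighbours B a] would be empty, although that in-neighbourhood
   contains [v]. *)
have NAn0 : in_neighbours A a != set0.
  by rewrite -tau_eq0 tauA tau_eq0.
rewrite NAn0 /= tauA.
have sCA : tau (in_neighbours B a) \subset A.
  exact: retentive_tau (minret_retentive minA) aA.
have Ck : #|tau (in_neighbours B a)| <= k.
  rewrite -tauA -ltnS (leq_trans _ Ak) // (leq_ltn_trans _ (card_in_neighbours aA)) //.
  exact/subset_leq_card/tau_sub.
rewrite setIAC (setIidPr sCA); apply: (IHn _ _ _ _ vN).
- exact: (minret_tau uniq_k Nn0 Ck).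
- exact: leqW.
- by apply: contra vA; apply: (subsetP sCA).
Qed.

(** * Weights and double counting *)

Definition lightly_dominable n A := exists w : T -> nat, forall S,
  S \subset A -> dominable n A S -> (\sum_(a in S) w a).*2 < \sum_(a in A) w a.

Lemma minret_uniqueS k :
    (forall A, #|A| <= k.+1 -> minret A A -> exists n, lightly_dominable n A) ->
  minret_unique k -> minret_unique k.+1.
Proof.
move=> light uniq_k B A1 A2 minA1 minA2 A1k A2k.
have [/eqP dis | ] := boolP (A1 :&: A2 == set0); last first.
  by case/set0Pn=> v /setIP[]; apply: (minret_eq minA1 minA2).
have nA21 v : v \in A2 -> v \notin A1.
  by move=> vA2; apply/negP=> vA1; have := in_set0 v; rewrite -dis inE vA1 vA2.
have nA12 v : v \in A1 -> v \notin A2.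
  by move=> vA1; apply/negP=> vA2; have := in_set0 v; rewrite -dis inE vA1 vA2.
have half A A' : minret B A -> #|A| <= k.+1 -> A' \subset B ->
    (forall v, v \in A' -> v \notin A) ->
  exists w : T -> nat, 0 < \sum_(a in A) w a /\ forall v, v \in A' ->
    (\sum_(a in A) w a * dominates v a).*2 < \sum_(a in A) w a.
  move=> minA Ak sA'B nA'A.
  have minAA : minret A A.
    by apply: (minret_hereditary uniq_k minA) => //; apply: minret_sub.
  have [n [w w_light]] := light A Ak minAA; exists w; split.
    (* The empty set is always dominable, so the total weight is positive. *)
    apply: leq_ltn_trans (leq0n _) (w_light set0 (sub0set _) _).
    by case: n {w_light} => //= n; apply/forall_inP=> a; rewrite inE.
  move=> v vA'; have vA := nA'A v vA'.
  have domA := minret_dominable n uniq_k minA Ak (subsetP sA'B v vA') vA.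
  have := w_light _ (subsetIl A _) domA.
  congr (_.*2 < _).
  rewrite (eq_bigl (fun a => (a \in A) && dominates v a)) => [|a]; last by rewrite !inE.
  by rewrite big_mkcondr; apply: eq_bigr => a _; case: dominates; rewrite ?muln1 ?muln0.
have [w1 [_ half1]] := half A1 A2 minA1 A1k (minret_sub minA2) nA21.
have [w2 [w2_gt0 half2]] := half A2 A1 minA2 A2k (minret_sub minA1) nA12.
set W1 := \sum_(a in A1) w1 a in half1; set W2 := \sum_(a in A2) w2 a in w2_gt0 half2.
(* The total weights of the edges from [A1] to [A2] and from [A2] to [A1]; an edge weighs the
   product of the weights of its ends. *)
pose E12 := \sum_(a in A1) \sum_(v in A2) w1 a * w2 v * dominates a v.
pose E21 := \sum_(a in A1) \sum_(v in A2) w1 a * w2 v * dominates v a.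
have sumE : E12 + E21 = W1 * W2.
  rewrite -big_split /= big_distrl; apply: eq_bigr => a aA1.
  rewrite -big_split /= big_distrr; apply: eq_bigr => v vA2 /=.
  rewrite -mulnDr; have av : a != v by apply: contraNneq (nA12 a aA1) => ->.
  have [dav | /negPf dav] := boolP (dominates a v).
    by rewrite (negPf (dominates_asym dav)) muln1.
  by have := dominates_complete av; rewrite dav => /= ->; rewrite muln1.
(* Each [a] in [A1] lies outside [A2], so it dominates less than half of [W2]. Strictness may be
   lost here, as [w1 a] may be 0. *)
have le12 : E12.*2 <= W1 * W2.
  rewrite -mul2n big_distrr big_distrl /=; apply: leq_sum => a aA1.
  rewrite mul2n (eq_bigr _ (fun v _ => esym (mulnA _ _ _))) -big_distrr /=.
  by rewrite doubleMr leq_mul // ltnW // half2.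
(* The gap of at least one in [half1], scaled by [w2 v] and summed over [v], amounts to [W2]; this
   keeps the bound strict even if some weights are 0. *)
have lt21 : E21.*2 + W2 <= W1 * W2.
  rewrite /E21 exchange_big /= -mul2n !big_distrr -big_split /=.
  apply: leq_sum => v vA2; rewrite (eq_bigr (fun a => w2 v * (w1 a * dominates v a))).
    by rewrite -big_distrr /= mul2n doubleMr -mulnSr mulnC leq_mul // half1.
  by move=> a _; rewrite mulnAC mulnC.
have := leq_add le12 (leq_trans _ lt21 : E21.*2 < W1 * W2).
by rewrite addnS -doubleD sumE addnn ltnn -addn1 leq_add2l => /(_ w2_gt0).
Qed.

End RetentiveSets.

(** * Enumeration of small tournaments *)

Fixpoint map2 (A B C : Type) (f : A -> B -> C) s t :=
  match s, t with
  | a :: s', b :: t' => f a b :: map2 f s' t'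
  | _, _ => [::]
  end.

Lemma map2_map (X A B C : Type) (f : A -> B -> C) (g : X -> A) (h : X -> B) s :
  map2 f (map g s) (map h s) = [seq f (g x) (h x) | x <- s].
Proof. by elim: s => //= x s ->. Qed.

Lemma mask_map_filter (X Y : Type) (p : pred X) (f : X -> Y) s :
  mask (map p s) (map f s) = map f (filter p s).
Proof. by elim: s => //= x s IHs; case: (p x); rewrite /= IHs. Qed.

(* A tournament on 0, ..., n-1 is given by the matrix whose row i is the
   characteristic bit sequence of the set of in-neighbours of i. *)

Definition band := map2 andb.
Definition bor := map2 orb.
Definition bsub b c := all id (map2 implb b c).

(** The identity matrix, whose rows encode the singletons. *)
Fixpoint units n : seq bitseq :=
  if n is n'.+1 then (true :: nseq n' false) :: map (cons false) (units n')
  else [::].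

Definition cstep (L : seq bitseq) c := foldr bor c (mask c L).

Definition creach L k u := iter k (cstep L) u.

(** Here [k] bounds the cardinality of [b], [L] lists the sets [tau_succ] and [K] the closures
    [reach]; the last line is the test of [mem_tau_reach]. *)
Fixpoint ctau k (m : seq bitseq) b :=
  if k is k'.+1 then
    let L := map2 (fun (i : bool) r =>
      if i then ctau k' m (band b r) else nseq (size m) false) b m in
    let K := map (creach L (count id b)) (units (size m)) in
    map2 (fun (i : bool) c => if i then all (bsub c) (mask c K) else false) b K
  else nseq (size m) false.

Definition cminimal (m : seq bitseq) :=
  let L := [seq ctau (size m) m r | r <- m] in
  all (fun u => all id (creach L (size m) u)) (units (size m)).

Fixpoint cdominable k (m : seq bitseq) b c :=
  if k is k'.+1 then
    all id (map2 (fun (i : bool) r =>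
      if i then
        let d := band b r in
        if has id d then
          let t := ctau (size m) m d in cdominable k' m t (band c t)
        else false
      else true) c m)
  else true.

Fixpoint bitseqs n : seq bitseq :=
  if n is n'.+1 then
    map (cons false) (bitseqs n') ++ map (cons true) (bitseqs n')
  else [:: [::]].

Definition light (w : seq nat) c := (sumn (mask c w)).*2 < sumn w.

(* The perceptron algorithm, run for at most k rounds. *)
Fixpoint train k (F : seq bitseq) w :=
  if k is k'.+1 then
    if filter (fun c => ~~ light w c) F is c :: _ then
      train k' F (map2 (fun (i : bool) x => if i then x.-1 else x.+1) c w)
    else w
  else w.

(** The weights returned by [train] are tested, not trusted, so no convergence of the perceptron has
    to be proved. *)
Definition check (m : seq bitseq) :=
  let n := size m in
  if cminimal m then
    let F := filter (cdominable n m (nseq n true)) (bitseqs n) in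
    let w := train 20 F (nseq n 1) in
    (size w == n) && all (light w) F
  else true.

(** [c] encodes the in-neighbours of the new vertex 0, which dominates exactly the other vertices;
    hence the negated bits in the new column. *)
Definition cext c (m : seq bitseq) :=
  (false :: c) :: map2 (fun i r => ~~ i :: r) c m.

(* The number of paths of length 1 or 2 ending in the vertex with row r. *)
Definition ckey (m : seq bitseq) (r : bitseq) :=
  sumn [seq (count id r').+1 | r' <- mask r m].

Definition head_max m :=
  if m is r :: _ then all (fun r' => ckey m r' <= ckey m r) m else true.

(* Every tournament on n vertices is listed up to isomorphism, since a vertex
   that maximises [ckey] may be put first. *)
Fixpoint mats n : seq (seq bitseq) :=
  if n is n'.+1 then
    filter head_max [seq cext c m | m <- mats n', c <- bitseqs n']
  else [:: [::]].

(** The finite case analysis, by evaluation. It starts at size 1: [check] fails on the empty matrix,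
    but retentive sets are nonempty. *)
Lemma check_mats : all (fun n => all check (mats n)) (iota 1 7).
Proof. by vm_compute. Qed.

Lemma mem_bitseqs b : b \in bitseqs (size b).
Proof.
elim: b => //= i b IHb; rewrite mem_cat.
by case: i; apply/orP; [right | left]; apply: map_f.
Qed.

(** * Correctness of the enumeration *)

Section Encoding.

Variable T : tournament.
Implicit Types (A B C S X Y : {set T}) (a u v x y : T) (s : seq T).

Local Notation tau := (@tau T).

(** The list [s] serves as a numbering of the vertices. *)
Definition bits s X : bitseq := [seq x \in X | x <- s].

Definition nbmat s : seq bitseq := [seq [seq dominates y x | y <- s] | x <- s].

Lemma size_nbmat s : size (nbmat s) = size s.
Proof. by rewrite size_map. Qed.

(** * Translation between vertex sets and bit sequences *)

Section Fixed.

Variable s : seq T.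
Hypothesis s_uniq : uniq s.

Local Notation bits := (bits s).
Local Notation m := (nbmat s).
Let V := [set x in s].

Lemma bits0 : bits set0 = nseq (size s) false.
Proof. by rewrite /bits; elim: s => //= x s' ->; rewrite inE. Qed.

Lemma bitsV : bits V = nseq (size s) true.
Proof.
apply: (@eq_from_nth _ false) => [|i]; rewrite !size_map ?size_nseq // => ltis.
have x0 : T by case: s ltis.
by rewrite (nth_map x0) // nth_nseq ltis inE mem_nth.
Qed.

Lemma band_bits X Y : band (bits X) (bits Y) = bits (X :&: Y).
Proof. by rewrite /band map2_map; apply: eq_map => x; rewrite inE. Qed.

Lemma bor_bits X Y : bor (bits X) (bits Y) = bits (X :|: Y).
Proof. by rewrite /bor map2_map; apply: eq_map => x; rewrite inE. Qed.

Lemma bsub_bits X Y : X \subset V -> bsub (bits X) (bits Y) = (X \subset Y).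
Proof.
move=> /subsetP sXV; rewrite /bsub map2_map all_map.
apply/allP/subsetP => [sub x xX | sXY x _] /=; last by apply/implyP/sXY.
by have:= sXV x xX; rewrite inE => /sub /implyP; apply.
Qed.

Lemma all_bits X : X \subset V -> all id (bits X) = (X == V).
Proof.
move=> sXV; rewrite all_map eqEsubset sXV /=.
by apply/allP/subsetP => sub x xs; apply: sub; move: xs; rewrite inE.
Qed.

Lemma has_bits X : X \subset V -> has id (bits X) = (X != set0).
Proof.
move=> /subsetP sXV; rewrite has_map.
apply/hasP/set0Pn => [[x _ xX] | [x xX]]; exists x => //.
by have := sXV x xX; rewrite inE.
Qed.

Lemma count_bits X : X \subset V -> count id (bits X) = #|X|.
Proof.
move=> sXV; rewrite count_map -size_filter -(card_uniqP _) ?filter_uniq //.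
apply: eq_card => x; rewrite mem_filter /=.
by case xX: (x \in X) => //=; have := subsetP sXV x xX; rewrite inE.
Qed.

Lemma mask_bits (Y : Type) X (f : T -> Y) :
  mask (bits X) (map f s) = [seq f x | x <- s & x \in X].
Proof. exact: mask_map_filter. Qed.

Lemma band_row B x :
  band (bits B) [seq dominates y x | y <- s] = bits (in_neighbours B x).
Proof. by rewrite /band map2_map; apply: eq_map => y; rewrite inE. Qed.

Lemma units_bits : units (size s) = [seq bits [set x] | x <- s].
Proof.
rewrite /bits; elim: s s_uniq => //= x s' IHs /andP[xs' /IHs ->].
have eqx y : y \in s' -> (y == x) = false.
  by move=> ys'; apply: contraNF xs' => /eqP <-.
congr (_ :: _).
  rewrite inE eqxx; congr (_ :: _).
  transitivity [seq false | _ <- s']; first by elim: (s') => //= _ s'' <-.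
  by apply/eq_in_map => y ys'; rewrite inE eqx.
rewrite -map_comp; apply/eq_in_map => y ys' /=.
by rewrite inE eq_sym eqx.
Qed.

Lemma cstep_bits (R : T -> {set T}) C : C \subset V ->
  cstep [seq bits (R x) | x <- s] (bits C) = bits (C :|: \bigcup_(x in C) R x).
Proof.
move=> /subsetP sCV; rewrite /cstep mask_bits.
have -> : \bigcup_(x in C) R x = \bigcup_(x <- [seq x <- s | x \in C]) R x.
  apply/setP=> y; apply/bigcupP/idP => [[x xC yR] | ].
    have xs : x \in [seq x <- s | x \in C].
      by rewrite mem_filter xC; have := sCV x xC; rewrite inE.
    by rewrite (big_rem x) //= inE yR.
  rewrite big_filter big_seq_cond /=.
  elim/big_ind: _ => [|X1 X2 IH1 IH2 | x /andP[_ xC] yR].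
  - by rewrite inE.
  - by case/setUP.
  - by exists x.
elim: [seq x <- s | x \in C] => [|x s' IHs] /=; first by rewrite big_nil setU0.
by rewrite big_cons IHs bor_bits setUCA.
Qed.

Lemma creach_bits (R : T -> {set T}) k C : (forall x, R x \subset V) -> C \subset V ->
  creach [seq bits (R x) | x <- s] k (bits C) =
  bits (iter k (fun C => C :|: \bigcup_(x in C) R x) C).
Proof.
move=> sRV sCV; rewrite /creach.
have [] : iter k (cstep [seq bits (R x) | x <- s]) (bits C) =
          bits (iter k (fun C => C :|: \bigcup_(x in C) R x) C) /\
          iter k (fun C => C :|: \bigcup_(x in C) R x) C \subset V; last by [].
elim: k => //= k [-> sV]; rewrite cstep_bits // subUset sV; split=> //=.
by apply/bigcupsP=> x _; apply: sRV.
Qed.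

Lemma reach_bits B (R : T -> {set T}) v : B \subset V -> v \in V ->
  (forall x, x \in V -> R x = tau_succ B x) ->
  creach [seq bits (R x) | x <- s] #|B| (bits [set v]) = bits (reach B v).
Proof.
move=> sBV vV eqR.
have -> : [seq bits (R x) | x <- s] = [seq bits (tau_succ B x) | x <- s].
  by apply/eq_in_map => x xs; rewrite eqR ?inE.
rewrite creach_bits ?sub1set // => x.
exact: subset_trans (tau_succ_sub _ _) sBV.
Qed.

(** The recursive calls concern in-neighbourhoods of members of [B], which are smaller than [B];
    with them [K] encodes the closures, and [mem_tau_reach] concludes. *)
Lemma ctau_bits k B : #|B| <= k -> B \subset V -> ctau k m (bits B) = bits (tau B).
Proof.
elim: k B => [|k IHk] B.
  by rewrite leqn0 cards_eq0 => /eqP -> _; rewrite /= size_nbmat tau0 bits0.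
move=> Bk sBV /=; rewrite {2}/nbmat map2_map size_nbmat count_bits //.
rewrite units_bits -map_comp map2_map.
have -> : [seq if x \in B then ctau k m (band (bits B) [seq dominates y x | y <- s])
               else nseq (size s) false | x <- s] = [seq bits (tau_succ B x) | x <- s].
  apply: eq_map => x; rewrite /tau_succ; case: ifP => xB; last by rewrite bits0.
  rewrite band_row IHk //; last exact: subset_trans (in_neighbours_sub _ _) sBV.
  by rewrite -ltnS (leq_trans (card_in_neighbours xB)).
have eqK :
    map (creach [seq bits (tau_succ B x) | x <- s] #|B| \o (fun x => bits [set x]))
      s = [seq bits (reach B x) | x <- s].
  by apply/eq_in_map => x xs /=; rewrite reach_bits // inE.
rewrite eqK /bits; apply/eq_in_map => x xs /=.
rewrite reach_bits ?inE //; case: ifP => [xB | nxB]; last first.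
  by apply/esym/negP => /(subsetP (tau_sub B)); rewrite nxB.
rewrite mask_bits all_map mem_tau_reach //.
have sRV u : u \in B -> reach B u \subset V.
  by move=> uB; apply: subset_trans (reach_sub uB) sBV.
apply/allP/forall_inP => sub u.
  move=> uR; have := sub u; rewrite mem_filter uR /= bsub_bits ?sRV //; apply.
  by have := subsetP (sRV x xB) u uR; rewrite inE.
by rewrite mem_filter /= => /andP[uR _]; rewrite bsub_bits ?sRV // sub.
Qed.

Lemma card_V : #|V| = size s.
Proof. by rewrite cardsE; apply/card_uniqP. Qed.

Lemma cminimal_nbmat : minimal_retentive tau V V -> cminimal m.
Proof.
move=> minV; rewrite /cminimal size_nbmat -map_comp units_bits all_map.
apply/allP=> v vs /=.
have -> : [seq (ctau (size s) m \o (fun x => [seq dominates y x | y <- s])) i | i <- s] =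
   [seq bits (tau_succ V x) | x <- s].
  apply/eq_in_map => x xs /=.
  have -> : [seq dominates y x | y <- s] = bits (in_neighbours V x).
    by apply/eq_in_map => y ys; rewrite !inE ys.
  rewrite ctau_bits ?in_neighbours_sub // /tau_succ ?inE ?xs // -card_V.
  exact/subset_leq_card/in_neighbours_sub.
by rewrite -card_V reach_bits // ?inE // (minret_reach minV) ?inE // all_bits.
Qed.

Lemma cdominable_bits k A S : A \subset V -> S \subset V ->
  cdominable k m (bits A) (bits S) = dominable k A S.
Proof.
elim: k A S => //= k IHk A S sAV sSV.
rewrite {2}/nbmat map2_map size_nbmat all_map.
have eqa a : a \in s ->
   (if has id (band (bits A) [seq dominates y a | y <- s])
        then cdominable k m (ctau (size s) m (band (bits A) [seq dominates y a | y <- s]))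
            (band (bits S) (ctau (size s) m (band (bits A) [seq dominates y a | y <- s])))
        else false) = (in_neighbours A a != set0) &&
      dominable k (tau (in_neighbours A a)) (S :&: tau (in_neighbours A a)).
  move=> sa; have sNV : in_neighbours A a \subset V.
    exact: subset_trans (in_neighbours_sub _ _) sAV.
  rewrite band_row has_bits // ctau_bits // -?card_V ?subset_leq_card // band_bits.
  rewrite IHk ?(subset_trans (tau_sub _)) //.
  exact: subset_trans (subsetIl _ _) sSV.
apply/allP/forall_inP => dom a.
  move=> aS; have as' : a \in s by have := subsetP sSV a aS; rewrite inE.
  by have := dom a as'; rewrite /= aS eqa.
by move=> as'; rewrite /= eqa //; case: ifP => // /dom.
Qed.

Lemma check_lightly_dominable :
  check m -> minimal_retentive tau V V -> lightly_dominable (size s) V.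
Proof.
move=> + minV; rewrite /check cminimal_nbmat // size_nbmat.
set F := filter _ _; set w := train _ _ _ => /andP[/eqP size_w /allP lightF].
(* Reading [w] through positions in [s] turns the list into a weight function on vertices. *)
have wE : w = [seq nth 0 w (index x s) | x <- s].
  apply: (@eq_from_nth _ 0) => [|i]; rewrite ?size_map // size_w => ltis.
  case: s s_uniq ltis => // x0 s' us ltis.
  by rewrite (nth_map x0) // index_uniq.
exists (fun x => nth 0 w (index x s)) => S sSV domS.
have sumE C : C \subset V -> sumn (mask (bits C) w) = \sum_(x in C) nth 0 w (index x s).
  move=> sCV; rewrite {1}wE mask_bits sumnE big_map big_filter -big_filter.
  rewrite -[RHS]big_filter; apply: perm_big; apply: uniq_perm.
  - exact: filter_uniq.
  - by rewrite filter_uniq // index_enum_uniq.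
  move=> x; rewrite !mem_filter mem_index_enum andbT.
  by case xC : (x \in C) => //=; have := subsetP sCV x xC; rewrite inE.
have : bits S \in F.
  rewrite mem_filter -bitsV cdominable_bits // domS.
  by have := mem_bitseqs (bits S); rewrite size_map.
move/lightF; rewrite /light sumE // -(sumE V) // bitsV mask_true // size_w.
by [].
Qed.

End Fixed.

(** * A listed matrix for every tournament *)

Definition key s x :=
  sumn [seq (count (fun z => dominates z y) s).+1 | y <- s & dominates y x].

Lemma ckey_nbmat s x : ckey (nbmat s) [seq dominates y x | y <- s] = key s x.
Proof.
rewrite /ckey /nbmat mask_map_filter -map_comp; congr sumn; apply: eq_map => y /=.
by rewrite count_map.
Qed.

(** As [key] does not depend on the numbering, a maximiser can be chosen before the other vertices
    are ordered. *)
Lemma key_perm s1 s2 x : perm_eq s1 s2 -> key s1 x = key s2 x.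
Proof.
move=> eqs; rewrite /key !sumnE !big_map (perm_big _ (perm_filter _ eqs)) /=.
by apply: eq_bigr => y _; rewrite (permP eqs).
Qed.

Lemma head_max_nbmat x s :
  (forall y, y \in x :: s -> key (x :: s) y <= key (x :: s) x) ->
  head_max (nbmat (x :: s)).
Proof.
by move=> maxx; apply/allP=> r /mapP[y ys ->]; rewrite !ckey_nbmat maxx.
Qed.

Lemma dominatesN x y : x != y -> dominates x y = ~~ dominates y x.
Proof.
move=> neq; apply/idP/idP => [/dominates_asym // | /negPf nyx].
by have := dominates_complete neq; rewrite nyx orbF.
Qed.

Lemma dominates_irr x : dominates x x = false.
Proof. by apply/negP=> xx; have := dominates_asym xx; rewrite xx. Qed.

Lemma nbmat_cons x s : x \notin s ->
  nbmat (x :: s) = cext [seq dominates y x | y <- s] (nbmat s).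
Proof.
move=> xs; rewrite /nbmat /cext map2_map /= dominates_irr; congr (_ :: _).
apply/eq_in_map => y ys; rewrite dominatesN //.
by apply: contraNneq xs => ->.
Qed.

(** A vertex of maximal [key] is put first, and the others are ordered by induction. *)
Lemma exists_nbmat_mats A :
  exists s, [/\ uniq s, A = [set x in s] & nbmat s \in mats #|A|].
Proof.
have [n An] : exists n, #|A| = n by exists #|A|.
elim: n => [|n IHn] in A An *; rewrite An.
  exists [::]; split=> //.
  by rewrite (cards0_eq An); apply/setP=> x; rewrite !inE.
have /card_gt0P[x0 x0A] : 0 < #|A| by rewrite An.
(* [enum A] is a provisional ordering; [key_perm] transfers maximality to [x :: s]. *)
have [x] := @arg_maxnP _ x0 (fun x => x \in A) (key (enum A)) x0A => xA maxx.
have cardA' : #|A :\ x| = n by move: An; rewrite (cardsD1 x) xA => -[].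
have [s [us defA' ms]] := IHn (A :\ x) cardA'.
have xs : x \notin s.
  have := setD11 x A; rewrite defA' inE => ->; by [].
have sA : x :: s =i A.
  by move=> y; rewrite -[in RHS](setD1K xA) defA' !inE.
have eqsA : perm_eq (x :: s) (enum A).
  by apply: uniq_perm; rewrite /= ?xs ?enum_uniq // => y; rewrite mem_enum sA.
exists (x :: s); split; first by rewrite /= xs.
  by apply/setP=> y; rewrite !inE -sA inE.
rewrite /= mem_filter head_max_nbmat => [|y].
  rewrite nbmat_cons //; apply: allpairs_f; first by rewrite -cardA'.
  have := mem_bitseqs [seq dominates y x | y <- s]; rewrite size_map.
  suff -> : size s = n by [].
  by move: cardA'; rewrite defA' cardsE (card_uniqP us).
by rewrite sA !(key_perm _ eqsA) => /maxx.
Qed.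

(** * Uniqueness up to size 7 *)

Lemma exists_lightly_dominable A :
  #|A| <= 7 -> minimal_retentive tau A A -> exists n, lightly_dominable n A.
Proof.
move=> A7 minA; have [s [us defA ms]] := exists_nbmat_mats A.
have A_gt0 : 0 < #|A|.
  by rewrite card_gt0 (retentive_neq0 (minret_retentive minA)).
exists (size s); rewrite defA; apply: check_lightly_dominable => //; rewrite -?defA //.
apply: (allP (allP check_mats #|A| _)) ms.
by rewrite mem_iota A_gt0.
Qed.

(** The induction starts vacuously at 0, retentive sets being nonempty; each step takes its weights
    from the enumeration. *)
Lemma minret_unique_le7 k : k <= 7 -> @minret_unique T k.
Proof.
elim: k => [_ B A1 A2 minA1 _ | k IHk k7].
  by rewrite leqn0 cards_eq0 (negPf (retentive_neq0 (minret_retentive minA1))).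
apply: minret_uniqueS (IHk (ltnW k7)) => A Ak.
exact/exists_lightly_dominable/(leq_trans Ak).
Qed.

End Encoding.

Theorem theorem7 :
  ~ exists (T : tournament) (R1 R2 : {set T}),
      [/\ R1 <> R2,
          minimal_tau_retentive R1, minimal_tau_retentive R2,
          #|R1| = 7 & #|R2| = 7].
Proof.
move=> [T [R1 [R2 [neq minR1 minR2 card1 card2]]]]; apply: neq.
by apply: (minret_unique_le7 (leqnn 7) minR1 minR2); rewrite ?card1 ?card2.
Qed.
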